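(* Let $t<0$ and suppose the target sets satisfy $\mathcal T=\mathrm{proj}_1^{-1}(\mathcal T_1)\cup \mathrm{proj}_2^{-1}(\mathcal T_2)$. (1) If the full system $\dot z=f(z,u)$, $z=(z_1,z_2,z_c)$, decomposes into self-contained subsystems, i.e. has the form $\dot z_1=f_1(z_1,z_c,u)$, $\dot z_2=f_2(z_2,z_c,u)$, $\dot z_c=f_c(z_c,u)$, then the maximal backward reachable tubes satisfy $$\bar{\mathcal R}(t)=\mathrm{proj}_1^{-1}(\bar{\mathcal R}_1(t))\cup \mathrm{proj}_2^{-1}(\bar{\mathcal R}_2(t)).$$ (2) If moreover the subsystem controls do not share any components, i.e. $u=(u_1,u_2)$ and the system has the form $\dot z_1=f_1(z_1,z_c,u_1)$, $\dot z_2=f_2(z_2,z_c,u_2)$, $\dot z_c=f_c(z_c)$, then in addition the minimal backward reachable tubes satisfy $$\bar{\mathcal A}(t)=\mathrm{proj}_1^{-1}(\bar{\mathcal A}_1(t))\cup \mathrm{proj}_2^{-1}(\bar{\mathcal A}_2(t)).$$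
   Context: System: $z\in\mathbb R^n$ evolves by $\dot z(s)=f(z(s),u(s))$, $s\in[t,0]$, $t<0$, with $u(s)\in\mathcal U$, $\mathcal U\subset\mathbb R^{n_u}$ compact; $f:\mathbb R^n\times\mathcal U\to\mathbb R^n$ is uniformly continuous, bounded, and Lipschitz in $z$ for fixed $u$. Control functions $u(\cdot)$ range over the set $\mathbb U$ of measurable functions $[t,0]\to\mathcal U$. For each $z$ and $u(\cdot)$ let $\zeta(s;z,t,u(\cdot))$, $s\in[t,0]$, be the unique trajectory (satisfying the ODE for almost every $s$) with $\zeta(t;z,t,u(\cdot))=z$. State partition: $z=(z_1,z_2,z_c)$ with $z_i\in\mathbb R^{n_i}$, $z_c\in\mathbb R^{n_c}$, $n_1,n_2>0$, $n_c\ge 0$, $n_1+n_2+n_c=n$. Subsystem states are $x_i=(z_i,z_c)\in\mathbb R^{n_i+n_c}$, $i=1,2$. Subsystem $i$ has dynamics $\dot z_i=f_i(z_i,z_c,u)$, $\dot z_c=f_c(z_c,u)$, and its trajectory starting at $x_i$ at time $t$ under $u(\cdot)$ is denoted $\xi_i(s;x_i,t,u(\cdot))$. When the subsystem controls share no components, they are chosen independently: $u=(u_1,u_2)$, $\mathcal U=\mathcal U_1\times\mathcal U_2$, and $\xi_i$ depends on $u(\cdot)$ only through $u_i(\cdot)$. Back-projection: for $S_i\subseteq\mathbb R^{n_i+n_c}$, $\mathrm{proj}_i^{-1}(S_i)=\{z=(z_1,z_2,z_c)\in\mathbb R^n:(z_i,z_c)\in S_i\}$. Target sets: $\mathcal T\subseteq\mathbb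 R^n$ (full system), $\mathcal T_i\subseteq\mathbb R^{n_i+n_c}$ (subsystem $i$). Backward reachable tubes: $\bar{\mathcal R}(t)=\{z:\exists u(\cdot)\in\mathbb U,\ \exists s\in[t,0],\ \zeta(s;z,t,u(\cdot))\in\mathcal T\}$ (maximal), $\bar{\mathcal A}(t)=\{z:\forall u(\cdot)\in\mathbb U,\ \exists s\in[t,0],\ \zeta(s;z,t,u(\cdot))\in\mathcal T\}$ (minimal), and for the subsystems $\bar{\mathcal R}_i(t)=\{x_i:\exists u(\cdot),\ \exists s\in[t,0],\ \xi_i(s;x_i,t,u(\cdot))\in\mathcal T_i\}$, $\bar{\mathcal A}_i(t)=\{x_i:\forall u(\cdot),\ \exists s\in[t,0],\ \xi_i(s;x_i,t,u(\cdot))\in\mathcal T_i\}$.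
   Formalization: ''Lipschitz in z for fixed u'' is taken with one Lipschitz constant valid for all u in U; with a constant depending on u the trajectory need not be unique, e.g. f(z,u)=u·min(1,max(0,z/u³)), f(z,0)=0, U=[0,1], u(s)=s−t, z(t)=0. *)

(* Defs.v *)
From mathcomp Require Import all_boot all_order all_algebra.
From mathcomp Require Import all_classical all_reals all_analysis.
From mathcomp Require Import measurable_realfun.
Set Implicit Arguments.
Unset Strict Implicit.
Unset Printing Implicit Defensive.
Import Order.TTheory GRing.Theory Num.Theory.
Import numFieldNormedType.Exports.
Local Open Scope classical_set_scope.
Local Open Scope ring_scope.

(* R with the sigma-algebra of Lebesgue-measurable (not only Borel) sets. *)
Definition lebesgue_type (R : realType) :=
  g_sigma_algebraType (completed_algebra_gen (@lebesgue_measure R)).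

(* Only the restriction of u to [t, 0] matters. A map into R^m is measurable
   iff its coordinates are. *)
Definition control (R : realType) (m : nat) (U : set 'rV[R]_m) (t : R) :
    set (R -> 'rV[R]_m) :=
  [set u : R -> 'rV[R]_m |
    (forall j, measurable_fun (`[t, 0] : set (lebesgue_type R))
                              (fun s => u s 0 j : R)) /\
    (forall s, s \in `[t, 0] -> U (u s))].

(* Absolute continuity on [a, b]: the [l i, r i] are non-overlapping. *)
Definition absolutely_continuous_on (R : realType) (n : nat) (a b : R)
    (y : R -> 'rV[R]_n) : Prop :=
  forall e : R, 0 < e -> exists2 d : R, 0 < d &
    forall (k : nat) (l r : 'I_k -> R),
      (forall i, [/\ a <= l i, l i <= r i & r i <= b]) ->
      (forall i j, i != j -> r i <= l j \/ r j <= l i) ->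
      \sum_(i < k) (r i - l i) < d ->
      \sum_(i < k) `|y (r i) - y (l i)| < e.

(* Caratheodory solutions on [t, 0]. An almost-everywhere ODE determines its
   solutions only among absolutely continuous functions. *)
Definition is_trajectory (R : realType) (n m : nat)
    (g : 'rV[R]_n -> 'rV[R]_m -> 'rV[R]_n) (t : R) (x : 'rV[R]_n)
    (u : R -> 'rV[R]_m) (y : R -> 'rV[R]_n) : Prop :=
  [/\ y t = x,
      absolutely_continuous_on t 0 y &
      {ae @lebesgue_measure R, forall s : R,
         s \in `[t, 0] -> is_derive s (1 : R) y (g (y s) (u s))}].

(* The trajectory y(s; x, t, u) as a function of s, meaningful on [t, 0];
   the choice is immaterial there, since under [regular] below the trajectory
   exists and is unique on [t, 0]. *)
Definition trajectory (R : realType) (n m : nat)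
    (g : 'rV[R]_n -> 'rV[R]_m -> 'rV[R]_n) (t : R) (x : 'rV[R]_n)
    (u : R -> 'rV[R]_m) : R -> 'rV[R]_n :=
  get [set y | is_trajectory g t x u y].

(* The Lipschitz constant in the state is uniform over U. If it could depend
   on v, trajectories need not be unique: take U = [0, 1],
   g z v = v * min 1 (max 0 (z / v^3)), g z 0 = 0, and u s = s - t; both
   0 and (s - t)^2 / 2 solve the ODE from z = 0 for s - t <= 1 / 2. *)
Definition regular (R : realType) (n m : nat)
    (g : 'rV[R]_n -> 'rV[R]_m -> 'rV[R]_n) (U : set 'rV[R]_m) : Prop :=
  [/\ unif_continuous
        (fun p : subspace ([set: 'rV[R]_n] `*` U) => g p.1 p.2),
      (exists M : R, forall z v, U v -> `|g z v| <= M) &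
      (exists L : R, forall v, U v -> L.-lipschitz (g ^~ v))].

Definition maximal_BRT (R : realType) (n m : nat)
    (g : 'rV[R]_n -> 'rV[R]_m -> 'rV[R]_n) (U : set 'rV[R]_m)
    (T : set 'rV[R]_n) (t : R) : set 'rV[R]_n :=
  [set x | exists u, control U t u /\
           exists s, s \in `[t, 0] /\ T (trajectory g t x u s)].

Definition minimal_BRT (R : realType) (n m : nat)
    (g : 'rV[R]_n -> 'rV[R]_m -> 'rV[R]_n) (U : set 'rV[R]_m)
    (T : set 'rV[R]_n) (t : R) : set 'rV[R]_n :=
  [set x | forall u, control U t u ->
           exists s, s \in `[t, 0] /\ T (trajectory g t x u s)].

(* The full state (z1, z2, zc) is row_mx (row_mx z1 z2) zc, and the state
   (zi, zc) of subsystem i is row_mx zi zc. *)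
Section Partition.
Variables (R : realType) (n1 n2 nc : nat).
Implicit Type z : 'rV[R]_(n1 + n2 + nc).

Definition part1 z : 'rV[R]_n1 := lsubmx (lsubmx z).
Definition part2 z : 'rV[R]_n2 := rsubmx (lsubmx z).
Definition partc z : 'rV[R]_nc := rsubmx z.

Definition back_proj1 (S : set 'rV[R]_(n1 + nc)) :
    set 'rV[R]_(n1 + n2 + nc) :=
  [set z | S (row_mx (part1 z) (partc z))].

Definition back_proj2 (S : set 'rV[R]_(n2 + nc)) :
    set 'rV[R]_(n1 + n2 + nc) :=
  [set z | S (row_mx (part2 z) (partc z))].

Definition coupled_dynamics (m : nat)
    (f1 : 'rV[R]_n1 -> 'rV[R]_nc -> 'rV[R]_m -> 'rV[R]_n1)
    (f2 : 'rV[R]_n2 -> 'rV[R]_nc -> 'rV[R]_m -> 'rV[R]_n2)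
    (fc : 'rV[R]_nc -> 'rV[R]_m -> 'rV[R]_nc)
    z (v : 'rV[R]_m) : 'rV[R]_(n1 + n2 + nc) :=
  row_mx (row_mx (f1 (part1 z) (partc z) v) (f2 (part2 z) (partc z) v))
         (fc (partc z) v).

End Partition.

Definition subsystem_dynamics (R : realType) (ni nc m : nat)
    (fi : 'rV[R]_ni -> 'rV[R]_nc -> 'rV[R]_m -> 'rV[R]_ni)
    (fc : 'rV[R]_nc -> 'rV[R]_m -> 'rV[R]_nc)
    (x : 'rV[R]_(ni + nc)) (v : 'rV[R]_m) : 'rV[R]_(ni + nc) :=
  row_mx (fi (lsubmx x) (rsubmx x) v) (fc (rsubmx x) v).

Definition control_product (R : realType) (m1 m2 : nat)
    (U1 : set 'rV[R]_m1) (U2 : set 'rV[R]_m2) : set 'rV[R]_(m1 + m2) :=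
  [set v | U1 (lsubmx v) /\ U2 (rsubmx v)].

(* Main.v *)
Require Import Defs.
From HB Require Import structures.
From mathcomp Require Import all_boot all_order all_algebra.
From mathcomp Require Import all_classical all_reals all_analysis.
From mathcomp Require Import ring lra measurable_realfun.
Set Implicit Arguments.
Unset Strict Implicit.
Unset Printing Implicit Defensive.
Import Order.TTheory GRing.Theory Num.Theory.
Import numFieldNormedType.Exports.
Local Open Scope classical_set_scope.
Local Open Scope ring_scope.

(** The two parts rest on one fact: for each control, the state of a subsystem
    along the full trajectory is the trajectory of that subsystem from the
    projected initial state ([trajectory_projection]). Hence the full trajectory
    is in [T] at time [s] exactly when one of the subsystem trajectories is in
    its target at time [s] ([target_trajectoryE]). For maximal tubes the
    existential quantifiers over [u] and [s] distribute over this disjunction.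
    For minimal tubes, one inclusion is immediate; for the other, controls [u1]
    and [u2] under which the two subsystems avoid their targets are spliced
    into a single control, which is possible because the subsystems read
    disjoint components.

    A trajectory is chosen among the Caratheodory solutions, so the fact above
    takes both existence of solutions for the full system and uniqueness for
    the subsystems. Uniqueness comes from a mean value inequality: an absolutely
    continuous [w] with [|w'| <= H'] almost everywhere, [H] nondecreasing,
    satisfies [|w b - w a| <= H b - H a]
    ([absolutely_continuous_mean_value_le]). Applied to the weight
    [expR (2 * L * (s - t))], where [L] is a Lipschitz constant of the dynamics,
    it shows that one integration halves the weighted distance of two curves
    ([bielecki_contraction]). The distance of two solutions is therefore 0, and
    Picard iterates converge. An iterate is a primitive of the velocity along
    the previous one; it exists because this velocity is Lebesgue measurable
    ([measurable_field_along]) and bounded, hence agrees almost everywhere with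
    a Borel function, to which the Lebesgue differentiation theorem applies
    ([bounded_measurable_primitive]). *)

(** * Derivatives as first-order approximations *)

Section derivative.
Context {R : realType} {V : normedModType R}.
Implicit Types (f : R -> V) (s : R) (v : V).

(** Stated without difference quotients, differentiability passes through
    nonexpansive linear maps and can be tested coordinate by coordinate. *)
Lemma is_derive1_approxP f s v :
  is_derive s (1 : R) f v <->
  forall e : R, 0 < e -> exists2 d : R, 0 < d &
    forall r, `|r - s| < d -> `|f r - f s - (r - s) *: v| <= e * `|r - s|.
Proof.
have approx (w : V) (h : R) : h != 0 ->
    `|h^-1 *: (f (h + s) - f s) - w| * `|h| = `|f (h + s) - f s - h *: w|.
  move=> h0; rewrite mulrC -normrZ scalerBr scalerA mulfV// scale1r//.
have quotE : (fun h : R => h^-1 *: ((f \o shift s) (h *: 1) - f s)) =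
             (fun h : R => h^-1 *: (f (h + s) - f s)).
  by apply/funext => h /=; rewrite [h *: 1]mulr1.
split=> [[]|fv].
- rewrite /derivable /derive quotE => /cvg_ex[/= l fl].
  have /= -> := cvg_lim (@norm_hausdorff _ _) fl.
  move=> <- e e0; move/cvgrPdist_le : fl => /(_ e e0)[d /= d0 dP].
  exists d => // r rsd; have [->|rs] := eqVneq r s.
    by rewrite !subrr normr0 mulr0 scale0r subrr normr0.
  have rs0 : r - s != 0 by rewrite subr_eq0.
  have := approx l _ rs0; rewrite subrK => <-.
  rewrite ler_wpM2r// distrC.
  have := dP (r - s); rewrite subrK; apply => //.
  by rewrite /ball_/= sub0r normrN.
- have fl : (fun h : R => h^-1 *: ((f \o shift s) (h *: 1) - f s)) @ 0^' --> v.
    rewrite quotE; apply/cvgrPdist_le => e e0.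
    have [d d0 dP] := fv e e0.
    exists d => //= h; rewrite /ball_/= sub0r normrN => hd h0.
    have := dP (h + s); rewrite addrK => /(_ hd).
    by rewrite -approx// ler_pM2r ?normr_gt0// distrC.
  split; first by apply/cvg_ex; exists v.
  exact: cvg_lim fl.
Qed.

(** Straddle lemma: as [l] and [r] lie on different sides of [s], the errors
    of the two approximations from [s] add up to a multiple of [r - l]. *)
Lemma is_derive1_straddle f s v (e : R) : is_derive s (1 : R) f v -> 0 < e ->
  exists2 d : R, 0 < d & forall l r, s - d < l -> l <= s -> s <= r ->
    r < s + d -> `|f r - f l - (r - l) *: v| <= e * (r - l).
Proof.
move=> /is_derive1_approxP/[apply] -[d d0 dP]; exists d => // l r ? ? ? ?.
have -> : f r - f l - (r - l) *: v =
    (f r - f s - (r - s) *: v) - (f l - f s - (l - s) *: v).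
  have -> : (r - l) *: v = (r - s) *: v - (l - s) *: v.
    by rewrite -scalerBl opprB addrA subrK.
  rewrite !opprD !opprK [RHS]addrACA [X in _ = X + _]addrACA.
  by rewrite addNr addr0.
have Hr : `|r - s| = r - s by apply: ger0_norm; lra.
have Hl : `|l - s| = s - l by rewrite ler0_norm; lra.
apply: le_trans (ler_normB _ _) _.
have := dP r; have := dP l; rewrite Hr Hl => /(_ _)/[swap] h1 h2.
have := h1 ltac:(lra); have := h2 ltac:(lra); lra.
Qed.
End derivative.

(** * A mean value inequality for absolutely continuous functions *)

(** The supremum of the points reached from [a] is itself reached, and could be
    passed if it were not [b]. Letting one step jump over [s], from [l] to [r],
    covers both of these uses. *)
Lemma interval_induction (R : realType) (P : R -> Prop) (a b : R) :
  a <= b -> P a ->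
  (forall s, a <= s <= b -> exists2 d : R, 0 < d &
     forall l r, a <= l -> r <= b -> s - d < l -> l <= s -> s <= r ->
       r < s + d -> P l -> P r) ->
  P b.
Proof.
move=> ab Pa step; pose A := [set s | a <= s <= b /\ P s].
have Aa : A a by split => //; rewrite lexx ab.
have Ab : ubound A b by move=> s [/andP[]].
have hA : has_sup A by split; [exists a | exists b].
pose c := sup A.
have ac : a <= c by apply: (ub_le_sup _ Aa); exists b.
have cb : c <= b by apply: ge_sup => //; exists a.
have [|d d0 dP] := step c; first by rewrite ac.
have [l [/andP[al lb] Pl] cdl] := sup_adherent d0 hA.
have lc : l <= c by apply: ub_le_sup; [exists b|split => //; rewrite al].
have cP r : c <= r -> r < c + d -> r <= b -> P r.
  by move=> cr rd rb; exact: (dP l).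
have [cb'|bc] := ltP c b; last by apply: cP => //; lra.
pose r := Num.min b (c + d / 2).
have rc : c < r by rewrite /r lt_min cb'/=; lra.
have rb : r <= b by rewrite /r ge_min lexx.
have rd : r < c + d by rewrite /r gt_min; apply/orP; right; lra.
suff : r <= c by lra.
apply: ub_le_sup; first by exists b.
split; first by rewrite rb andbT; lra.
by apply: cP => //; lra.
Qed.

Section absolutely_continuous_increment.
Context {R : realType} {n : nat}.
Notation mu := (@lebesgue_measure R).
Implicit Types (w : R -> 'rV[R]_n) (H : R -> R).

Lemma null_set_open_cover (N : set R) (d : R) : mu.-negligible N -> 0 < d ->
  exists G : set R, [/\ open G, N `<=` G & (mu G < d%:E)%E].
Proof.
move=> [B [mB B0 NB]] d0.
have Bfin : (mu B < +oo)%E by rewrite B0 ltry.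
have [G [oG BG GB]] := lebesgue_regularity_outer mB Bfin d0.
exists G; split => //; first exact: subset_trans NB BG.
have mG : measurable G by exact: open_measurable.
have mGB : measurable (G `\` B) by exact: measurableD.
rewrite -(setDKU BG); apply: (@le_lt_trans _ _ (mu (G `\` B) + mu B)%E).
  exact: measureU2.
by rewrite B0 adde0.
Qed.

(** The measure of the part of [G] to the left of a point bounds the total
    length of the non-overlapping intervals of [G] collected up to there. *)
Lemma measure_open_initial_seg_le (G : set R) (l r : R) : open G ->
  (mu G < +oo)%E -> l <= r -> `]l, r] `<=` G ->
  fine (mu (G `&` `]-oo, l])) + (r - l) <= fine (mu (G `&` `]-oo, r])).
Proof.
move=> oG finG lr lrG.
have mG : measurable G by exact: open_measurable.
have finI s : mu (G `&` `]-oo, s]) \is a fin_num.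
  rewrite ge0_fin_numE// (le_lt_trans _ finG)// le_measure ?inE//.
  exact: measurableI.
rewrite -lee_fin EFinD !fineK//.
have -> : (r - l)%:E = mu `]l, r]%classic.
  rewrite lebesgue_measure_itv/= lte_fin -EFinD.
  by case: ltP => // rl; congr EFin; lra.
rewrite -measureU//=; [|exact: measurableI|].
- rewrite le_measure ?inE//; first by apply: measurableU => //;
    exact: measurableI.
    exact: measurableI.
  move=> x [[Gx]|]/=; rewrite !in_itv/= => xl; split => //; [lra| |lra].
  by apply: lrG; rewrite /= in_itv.
- by rewrite -subset0 => x [[_]]/=; rewrite !in_itv/=; lra.
Qed.

(** A form of [|w'(s)| <= H'(s)] for intervals that straddle [s]. *)
Definition increment_dominated w H s := forall e : R, 0 < e ->
  exists2 d : R, 0 < d & forall l r, s - d < l -> l <= s -> s <= r ->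
    r < s + d -> `|w r - w l| <= H r - H l + e * (r - l).

(** Walk from [a] to [b]. At a point outside the exceptional null set the step
    is paid for by [H], up to [e' * (r - l)]. The exceptional points are covered
    by an open set [G] of measure less than the modulus of absolute continuity
    for [e']; a step inside [G] is recorded in a list of non-overlapping
    intervals whose increments sum up to less than [e']. *)
Theorem absolutely_continuous_increment_le (a b : R) w H : a <= b ->
  absolutely_continuous_on a b w ->
  {in `[a, b] &, {homo H : x y / x <= y}} ->
  {ae mu, forall s, s \in `[a, b] -> increment_dominated w H s} ->
  `|w b - w a| <= H b - H a.
Proof.
move=> ab acw ndH domw; apply/ler_addgt0Pr => e e0.
(* With this choice the two kinds of steps cost [e] altogether. *)
pose e' := e / (b - a + 1).
have e'0 : 0 < e' by rewrite divr_gt0//; lra.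
have -> : e = e' * (b - a) + e' by rewrite /e'; field; lra.
have [d d0 acd] := acw _ e'0.
have [G [oG NG Gd]] := null_set_open_cover domw d0.
have finG : (mu G < +oo)%E by rewrite (lt_trans Gd)// ltry.
pose m s := fine (mu (G `&` `]-oo, s])).
have m0 s : 0 <= m s by exact: fine_ge0.
have mG : measurable G by exact: open_measurable.
have finI s : mu (G `&` `]-oo, s]) \is a fin_num.
  rewrite ge0_fin_numE// (le_lt_trans _ finG)// le_measure ?inE//.
  exact: measurableI.
have mm s r : s <= r -> m s <= m r.
  move=> sr; rewrite fine_le// le_measure ?inE//; try exact: measurableI.
  by apply: setIS; apply: subset_itvl; rewrite bnd_simp.
have md s : m s < d.
  rewrite -lte_fin fineK// (le_lt_trans _ Gd)// le_measure ?inE//.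
  exact: measurableI.
pose P s := exists (k : nat) (l r : nat -> R), [/\
  (forall i, (i < k)%N -> [/\ a <= l i, l i <= r i & r i <= s]),
  (forall i j, (i < j)%N -> (j < k)%N -> r i <= l j),
  \sum_(i < k) (r i - l i) <= m s &
  `|w s - w a| <= H s - H a + e' * (s - a) + \sum_(i < k) `|w (r i) - w (l i)|].
suff [k [l [r [lrb sep len incr]]]] : P b.
  apply: le_trans incr _; rewrite -addrA lerD2l lerD2l; apply/ltW/acd.
  - by move=> i; exact: lrb.
  - move=> i j; rewrite neq_lt => /orP[] ij; [left|right]; exact: sep.
  - exact: le_lt_trans len (md _).
apply: (interval_induction ab).
  exists 0%N, (fun=> 0), (fun=> 0); split => //; first by rewrite big_ord0.
  by rewrite !subrr normr0 mulr0 big_ord0 !addr0.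
move=> s sab.
have [sG|sG] := pselect (G s).
(* At a point of [G], append the interval [l, r] to the recorded list. *)
- have [d' d'0 d'G] : exists2 d' : R, 0 < d' & ball s d' `<=` G.
    by have /nbhs_ballP[d'] := oG _ sG; exists d'.
  exists d' => // l r al rb sdl ls sr rsd [k [L [Q [LQ sep len incr]]]].
  have lr : l <= r by exact: le_trans sr.
  exists k.+1, (fun i => if i == k then l else L i),
    (fun i => if i == k then r else Q i).
  have sumE (F : R -> R -> R) :
      \sum_(i < k.+1) F (if i == k :> nat then r else Q i)
                        (if i == k :> nat then l else L i) =
      \sum_(i < k) F (Q i) (L i) + F r l.
    rewrite big_ord_recr/= eqxx; congr (_ + _); apply: eq_bigr => i _.
    by rewrite ltn_eqF.
  split.
  + move=> i; rewrite ltnS leq_eqVlt; case: eqP => //= _ ik.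
    by have [? ? ?] := LQ _ ik; split => //; lra.
  + move=> i j ij; rewrite ltnS leq_eqVlt.
    case: (eqVneq j k) => /= [jk _|jk jk'].
      by rewrite ltn_eqF -?jk//; have [|_ _] := LQ i; [rewrite -jk|lra].
    by rewrite ltn_eqF ?(ltn_trans ij)//; exact: sep.
  + rewrite (sumE (fun x y => x - y)).
    apply: le_trans (measure_open_initial_seg_le oG finG lr _).
      by rewrite lerD2r.
    move=> x /=; rewrite in_itv/= => xlr; apply: d'G.
    by rewrite /ball/= ltr_distlC; lra.
  + rewrite (sumE (fun x y => `|w x - w y|)).
    have Hlr : H l <= H r by apply: ndH => //; rewrite in_itv/=; lra.
    have elr : e' * (l - a) <= e' * (r - a) by rewrite ler_pM2l//; lra.
    have := ler_distD (w l) (w r) (w a); lra.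
- have sdom : increment_dominated w H s.
    apply: contrapT => ndom; apply: sG; apply: NG => /= dom.
    by apply: ndom; apply: dom; rewrite in_itv.
  have [d' d'0 d'P] := sdom _ e'0.
  exists d' => // l r al rb sdl ls sr rsd [k [L [Q [LQ sep len incr]]]].
  have lr : l <= r by exact: le_trans sr.
  exists k, L, Q; split => //.
  + by move=> i /LQ[? ? ?]; split => //; exact: le_trans lr.
  + exact: le_trans len (mm _ _ lr).
  + have := d'P l r sdl ls sr rsd.
    have := ler_distD (w l) (w r) (w a); lra.
Qed.
End absolutely_continuous_increment.

Section growth.
Context {R : realType} {n : nat}.
Notation mu := (@lebesgue_measure R).
Implicit Types (w v : R -> 'rV[R]_n) (H h : R -> R).

Lemma derivative_increment_dominated w H s (v : 'rV[R]_n) (h : R) :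
  is_derive s (1 : R) w v -> is_derive s (1 : R) (H : R -> R^o) h ->
  `|v| <= h -> increment_dominated w H s.
Proof.
move=> wv Hh vh e e0; have e2 : 0 < e / 2 by rewrite divr_gt0.
have [d1 d10 w1] := is_derive1_straddle wv e2.
have [d2 d20 H1] := is_derive1_straddle Hh e2.
exists (Num.min d1 d2); first by rewrite lt_min d10.
move=> l r sdl ls sr rsd.
have dd1 : Num.min d1 d2 <= d1 by rewrite ge_min lexx.
have dd2 : Num.min d1 d2 <= d2 by rewrite ge_min lexx orbT.
have rl : 0 <= r - l by lra.
have wlr : `|w r - w l - (r - l) *: v| <= e / 2 * (r - l) by apply: w1; lra.
have : `|H r - H l - (r - l) * h| <= e / 2 * (r - l) by apply: H1; lra.
rewrite ler_norml => /andP[Hlr _].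
have vlr : `|(r - l) *: v| <= (r - l) * h.
  by rewrite normrZ ger0_norm// ler_wpM2l.
have := ler_normD (w r - w l - (r - l) *: v) ((r - l) *: v).
rewrite subrK; lra.
Qed.

Lemma absolutely_continuous_onS (a b c : R) w : c <= b ->
  absolutely_continuous_on a b w -> absolutely_continuous_on a c w.
Proof.
move=> cb acw e /acw[d d0 acd]; exists d => // k l r lr.
by apply: acd => i; have [? ? ?] := lr i; split => //; exact: le_trans cb.
Qed.

Lemma absolutely_continuous_onB (a b : R) w1 w2 :
  absolutely_continuous_on a b w1 -> absolutely_continuous_on a b w2 ->
  absolutely_continuous_on a b (w1 - w2).
Proof.
move=> ac1 ac2 e e0; have e2 : 0 < e / 2 by rewrite divr_gt0.
have [d1 d10 ac1d] := ac1 _ e2; have [d2 d20 ac2d] := ac2 _ e2.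
exists (Num.min d1 d2); first by rewrite lt_min d10.
move=> k l r lr sep; rewrite lt_min => /andP[len1 len2].
have := ac1d k l r lr sep len1; have := ac2d k l r lr sep len2.
set S2 := (X in X < _) => S2e; set S1 := (X in X < _) => S1e.
apply: (@le_lt_trans _ _ (S1 + S2)); last lra.
rewrite -big_split/=; apply: ler_sum => i _.
rewrite !fctE opprD addrACA -opprD; exact: ler_normB.
Qed.

Lemma lipschitz_absolutely_continuous (a b M : R) w : 0 <= M ->
  (forall l r, a <= l -> l <= r -> r <= b -> `|w r - w l| <= M * (r - l)) ->
  absolutely_continuous_on a b w.
Proof.
move=> M0 lipw e e0; exists (e / (M + 1)); first by rewrite divr_gt0//; lra.
move=> k l r lr sep len.
apply: (@le_lt_trans _ _ (M * \sum_(i < k) (r i - l i))).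
  rewrite mulr_sumr; apply: ler_sum => i _.
  by have [? ? ?] := lr i; exact: lipw.
have : (M + 1) * (\sum_(i < k) (r i - l i)) < e.
  by rewrite mulrC -ltr_pdivlMr//; lra.
have : 0 <= \sum_(i < k) (r i - l i).
  by apply: sumr_ge0 => i _; have [? ? ?] := lr i; lra.
lra.
Qed.

(** Comparing [w] with a primitive [H] of the bound [h] on its derivative takes
    the place of estimating an integral of [v]. *)
Lemma absolutely_continuous_mean_value_le (a b : R) w v H h :
  absolutely_continuous_on a b w ->
  (forall s, is_derive s (1 : R) (H : R -> R^o) (h s)) ->
  {homo H : x y / x <= y} ->
  {ae mu, forall s, s \in `[a, b] -> is_derive s (1 : R) w (v s)} ->
  (forall s, s \in `[a, b] -> `|v s| <= h s) ->
  forall s, s \in `[a, b] -> `|w s - w a| <= H s - H a.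
Proof.
move=> acw Hh ndH wv vh s; rewrite in_itv/= => /andP[as_ sb].
apply: absolutely_continuous_increment_le => //.
- exact: absolutely_continuous_onS acw.
- by move=> x y _ _; exact: ndH.
- apply: (@filterS _ _ (ae_filter_ringOfSetsType mu) _ _ _ wv) => x wvx.
  rewrite in_itv/= => /andP[ax xs].
  have xab : x \in `[a, b] by rewrite in_itv/= ax (le_trans xs).
  exact: derivative_increment_dominated (wvx xab) (Hh x) (vh x xab).
Qed.

(** The weight of Bielecki's norm: with the rate [2 * L], twice the Lipschitz
    constant, one integration halves the weighted norm. *)
Definition bielecki (L t s : R) : R := expR (2 * L * (s - t)).

Lemma bielecki_ge1 (L t s : R) : 0 <= L -> t <= s -> 1 <= bielecki L t s.
Proof.
by move=> L0 ts; rewrite -expR0 ler_expR !mulr_ge0// subr_ge0.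
Qed.

Lemma is_derive_affine (c a s : R) :
  is_derive s (1 : R) (fun x : R => c * (x - a) : R^o) c.
Proof.
apply/is_derive1_approxP => e e0; exists 1 => // r _.
rewrite [X in `|X|](_ : _ = 0) ?normr0 ?mulr_ge0 ?(ltW e0)//.
by rewrite /GRing.scale/=; ring.
Qed.

Lemma is_derive_bielecki (L t s : R) :
  is_derive s (1 : R) (bielecki L t : R -> R^o) (2 * L * bielecki L t s).
Proof.
rewrite [_ * bielecki _ _ _]mulrC.
exact: (@is_derive1_comp _ expR (fun x : R => 2 * L * (x - t)) s _ _
  (is_derive_expR _) (is_derive_affine _ _ _)).
Qed.

Lemma le_bielecki (L t : R) : 0 <= L -> {homo bielecki L t : x y / x <= y}.
Proof.
move=> L0 x y xy; rewrite ler_expR ler_wpM2l ?mulr_ge0// lerD2r//.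
Qed.

(** A function that starts at 0 and whose derivative is bounded by [L] times a
    weighted bound [C] satisfies the weighted bound [C / 2]. Both the uniqueness
    of trajectories and the convergence of Picard iterates iterate this. *)
Lemma bielecki_contraction (L C t b : R) w v : 0 <= L -> 0 <= C ->
  absolutely_continuous_on t b w -> w t = 0 ->
  {ae mu, forall s, s \in `[t, b] -> is_derive s (1 : R) w (v s)} ->
  (forall s, s \in `[t, b] -> `|v s| <= L * (C * bielecki L t s)) ->
  forall s, s \in `[t, b] -> `|w s| <= C / 2 * bielecki L t s.
Proof.
move=> L0 C0 acw wt0 wv vC s stb.
have : `|w s - w t| <= C / 2 * bielecki L t s - C / 2 * bielecki L t t.
  apply: (absolutely_continuous_mean_value_le
      (H := fun s => C / 2 * bielecki L t s) acw _ _ wv vC) => //.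
  - move=> x; have := is_deriveZ (C / 2) (is_derive_bielecki L t x).
    rewrite [_ *: _](_ : _ = L * (C * bielecki L t x))//.
    by rewrite /GRing.scale/=; field.
  - by move=> x y xy; rewrite ler_wpM2l ?divr_ge0// le_bielecki.
rewrite wt0 subr0 => /le_trans; apply.
by rewrite gerBl mulr_ge0 ?divr_ge0// expR_ge0.
Qed.

Lemma halving_lt (C e : R) : 0 < e -> exists k : nat, C / 2 ^+ k < e.
Proof.
move=> e0; have half1 : `|2^-1 : R| < 1 by rewrite ger0_norm; lra.
have /cvgrPdist_lt/(_ _ e0)[k _ /(_ k (leqnn k))] := cvg_geometric C half1.
by rewrite /geometric/= sub0r normrN exprVn => /ltr_normlW; exists k.
Qed.

Lemma le_of_halving (x y C : R) :
  (forall k : nat, x <= y + C / 2 ^+ k) -> x <= y.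
Proof.
move=> xy; apply/ler_addgt0Pr => e e0.
by have [k Ck] := halving_lt C e0; have := xy k; lra.
Qed.

End growth.

(** * Primitives of bounded Lebesgue-measurable functions *)

Section primitive.
Context {R : realType}.
Notation mu := (@lebesgue_measure R).

Lemma borel_lebesgue_measurable (A : set R) :
  measurable A -> measurable (A : set (lebesgue_type R)).
Proof.
move=> mA; change ((completed_algebra_gen mu).-sigma.-measurable A).
rewrite g_sigma_completed_algebra_genE.
by exists A => //; exists set0; [exact: negligible_set0|rewrite setU0].
Qed.

(** Each of the countably many sets [phi > q], [q] rational, is Borel up to a
    null set; discarding these null sets makes [phi] Borel, which brings it
    within reach of Lebesgue integration on the Borel sigma-algebra. *)
Lemma lebesgue_measurable_borel_ae (D : set R) (phi : R -> R) :
  measurable D -> measurable_fun (D : set (lebesgue_type R)) phi ->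
  exists N : set R,
    [/\ measurable N, mu N = 0 & measurable_fun (D `\` N) phi].
Proof.
move=> mD mphi.
pose A (q : rat) : set R := D `&` phi @^-1` `]ratr q, +oo[.
have LA q : completed_algebra_gen mu (A q).
  rewrite -g_sigma_completed_algebra_genE.
  by apply: mphi; [exact: borel_lebesgue_measurable|exact: measurable_itv].
have /choice[B BP] : forall q, exists B : set R,
    measurable B /\ exists2 M : set R, mu.-negligible M & B `|` M = A q.
  by move=> q; have [B mB [M nM BM]] := LA q; exists B; split => //; exists M.
have /choice[M MP] : forall q, exists M : set R,
    mu.-negligible M /\ B q `|` M = A q.
  by move=> q; have [_ [M nM BM]] := BP q; exists M.
pose M' (k : nat) := if unpickle k is Some q then M q else set0.
have [N [mN N0 MN]] : mu.-negligible (\bigcup_k M' k).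
  apply: negligible_bigcup => k; rewrite /M'.
  by case: unpickle => [q|]; [have [] := MP q|exact: negligible_set0].
have MN' q : M q `<=` N.
  by move=> x Mx; apply: MN; exists (pickle q); [exact: I|rewrite /M' pickleK].
exists N; split => //.
apply: (measurability (@RGenOInfty.G R)); first exact: RGenOInfty.measurableE.
move=> _ [_ [r ->] <-].
have -> : (D `\` N) `&` phi @^-1` `]r, +oo[ =
    \bigcup_(q in [set q : rat | r < ratr q]) (B q `\` N).
  apply/seteqP; split => x.
  - move=> [[Dx Nx]]; rewrite /= in_itv/= andbT => /rat_in_itvoo[q].
    rewrite in_itv/= => /andP[rq qx]; exists q => //; split => //.
    have : A q x by split => //; rewrite /= in_itv/= qx.
    by have [_ <-] := MP q => -[//|/(MN' q)].
  - move=> [q /= rq [Bx Nx]].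
    have : A q x by have [_ <-] := MP q; left.
    move=> [Dx]; rewrite /= !in_itv/= !andbT => qx; split => //.
    exact: lt_trans qx.
rewrite bigcup_mkcond; apply: countable_bigcupT_measurable => // q.
case: ifPn => // _; apply: measurableD => //.
by have [] := BP q.
Qed.

Lemma bounded_measurable_primitive (a b M : R) (phi : R -> R) : 0 <= M ->
  measurable_fun (`[a, b] : set (lebesgue_type R)) phi ->
  (forall s, s \in `[a, b] -> `|phi s| <= M) ->
  exists Phi : R -> R, [/\ Phi a = 0,
    forall l r, a <= l -> l <= r -> r <= b -> `|Phi r - Phi l| <= M * (r - l) &
    {ae mu, forall s, s \in `[a, b] ->
       is_derive s (1 : R) (Phi : R -> R^o) (phi s)}].
Proof.
move=> M0 mphi phiM.
have mab : measurable (`[a, b] : set R) by exact: measurable_itv.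
have [N [mN N0 mphiN]] := lebesgue_measurable_borel_ae mab mphi.
pose psi := phi \_ (`[a, b] `\` N).
have mabN : measurable (`[a, b] `\` N : set R) by exact: measurableD.
have mpsi : measurable_fun setT psi := (measurable_restrictT phi mabN).1 mphiN.
have psiM x : `|psi x| <= M.
  rewrite /psi patchE; case: ifPn => [|_]; last by rewrite normr0.
  by rewrite inE => -[/phiM].
have ipsi (A : set R) : measurable A -> (mu A < +oo)%E ->
    mu.-integrable A (EFin \o psi).
  move=> mA Afin; apply: measurable_bounded_integrable => //.
    exact: measurable_funS mpsi.
  exists M; split; first exact: num_real.
  by move=> K MK x _; exact: le_trans (psiM x) (ltW MK).
have itvfin (l r : R) : (mu `[l, r]%classic < +oo)%E.
  by rewrite lebesgue_measure_itv/=; case: ifP => _; rewrite ltry.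
have ipsi_itv r : mu.-integrable `[a, r] (EFin \o psi).
  by apply: ipsi => //; exact: measurable_itv.
have lpsi : locally_integrable setT psi.
  split => //; first exact: openT.
  move=> K _ cK; have mK : measurable K by exact: compact_measurable.
  have := ipsi _ mK (compact_finite_measure cK).
  by move=> /integrableP[].
exists (fun s => \int[mu]_(x in `[a, s]) psi x); split.
- by rewrite set_itv1 Rintegral_set1.
- move=> l r al lr rb.
  rewrite (Rintegral_itvB (ipsi_itv r)) ?bnd_simp//.
  have mlr : measurable (`]l, r] : set R) by exact: measurable_itv.
  have mulr : mu `]l, r]%classic = (r - l)%:E.
    rewrite lebesgue_measure_itv/= lte_fin -EFinD.
    by case: ltP => // rl; congr EFin; lra.
  have ilr : (mu `]l, r]%classic < +oo)%E by rewrite mulr ltry.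
  apply: le_trans; first exact: le_normr_Rintegral (ipsi _ mlr ilr).
  have -> : M * (r - l) = \int[mu]_(x in `]l, r]) M.
    rewrite Rintegral_cst//; congr (_ * _).
    transitivity (fine (mu `]l, r]%classic)); last by []. by rewrite mulr.
  apply: le_Rintegral => //.
  + by have /integrable_norm := ipsi _ mlr ilr.
  + apply: measurable_bounded_integrable => //.
    exists M; split; first exact: num_real.
    by move=> K MK x _; rewrite ger0_norm// ltW.
- have := FTC1 ipsi_itv lpsi.
  have nN : {ae mu, forall s, ~ (N `|` [set a]) s}.
    have nNa : mu.-negligible (N `|` [set a]).
      apply: negligibleU; apply/negligibleP => //; exact: lebesgue_measure_set1.
    by apply: negligibleS nNa => x /= /contrapT.
  apply: (@filterS2 _ _ (ae_filter_ringOfSetsType mu) _ _ _ _ nN).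
  move=> s Ns dPhi sab.
  have as_ : a < s.
    rewrite lt_neqAle; move: (sab); rewrite in_itv/= => /andP[-> _].
    rewrite andbT; by apply/eqP => as_; apply: Ns; right.
  have [|dPhis PhiE] := dPhi; first by rewrite lte_fin.
  split => //; rewrite -derive1E PhiE /psi patchE ifT// inE.
  by split => // Nsx; apply: Ns; left.
Qed.

End primitive.

(** * Measurability of the velocity along a control *)

Section measurability.
Context {R : realType}.

Lemma rV_norm_coord_le n (v : 'rV[R]_n) j : `|v 0 j| <= `|v|.
Proof. by rewrite [leRHS]mx_normrE; exact: (le_bigmax _ _ (0, j)). Qed.

Lemma rV_dist_coord_le n (v v' : 'rV[R]_n) j : `|v 0 j - v' 0 j| <= `|v - v'|.
Proof. by have := rV_norm_coord_le (v - v') j; rewrite !mxE. Qed.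

Lemma rV_norm_le n (v : 'rV[R]_n) (e : R) : 0 <= e ->
  (forall j, `|v 0 j| <= e) -> `|v| <= e.
Proof.
move=> e0 ve; rewrite [leLHS]mx_normrE; apply: bigmax_le => // -[i j] _.
by rewrite ord1.
Qed.

Lemma norm_lsubmx_le n m (v : 'rV[R]_(n + m)) : `|lsubmx v| <= `|v|.
Proof. by apply: rV_norm_le => // j; rewrite mxE; exact: rV_norm_coord_le. Qed.

Lemma norm_rsubmx_le n m (v : 'rV[R]_(n + m)) : `|rsubmx v| <= `|v|.
Proof. by apply: rV_norm_le => // j; rewrite mxE; exact: rV_norm_coord_le. Qed.

(** The preimage of [F > c] is the union of the preimages of those cells of the
    grids of mesh [1 / i.+1] on which [F > c] within [W]. There are countably
    many cells, and a cell is cut out by conditions on the coordinates. *)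
Lemma measurable_fun_rV_comp d (T : measurableType d) n (D : set T)
    (w : T -> 'rV[R]_n) (W : set 'rV[R]_n) (F : 'rV[R]_n -> R) :
  measurable D -> (forall j, measurable_fun D (fun s => w s 0 j)) ->
  (forall s, D s -> W (w s)) ->
  (forall v, W v -> forall e : R, 0 < e -> exists2 r : R, 0 < r &
     forall v', W v' -> `|v' - v| < r -> `|F v' - F v| < e) ->
  measurable_fun D (F \o w).
Proof.
move=> mD mw wW cF.
apply: (measurability (@RGenOInfty.G R)); first exact: RGenOInfty.measurableE.
move=> _ [_ [c ->] <-].
pose side (i : nat) (z : int) : set R :=
  `[z%:~R / i.+1%:R, (z + 1)%:~R / i.+1%:R[%classic.
pose cell i (p : 'rV[int]_n) : set 'rV[R]_n :=
  [set v | forall j, side i (p 0 j) (v 0 j)].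
pose inside (q : nat * 'rV[int]_n) :=
  forall v, W v -> cell q.1 q.2 v -> c < F v.
have -> : D `&` (F \o w) @^-1` `]c, +oo[ =
    \bigcup_(q in inside) (D `&` w @^-1` cell q.1 q.2).
  apply/seteqP; split => s; last first.
    move=> [q /= qin [Ds ws]]; split => //=.
    by rewrite in_itv/= qin//; exact: wW.
  move=> [Ds]; rewrite /= in_itv/= andbT => cFs.
  have [||r r0 Fr] := cF (w s) _ (F (w s) - c).
  - exact: wW.
  - by rewrite subr_gt0.
  have [i _ /(_ i (leqnn i)) ir] := near_infty_natSinv_lt (PosNum r0).
  pose p : 'rV[int]_n := \row_j Num.floor (w s 0 j * i.+1%:R).
  have i0 : (0 : R) < i.+1%:R by [].
  exists (i, p); last first.
    split => // j; rewrite /side/= in_itv/= mxE ler_pdivrMr// ltr_pdivlMr//.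
    exact: floor_itv.
  move=> v Wv /= vp.
  suff vr : `|v - w s| < r by have := Fr v Wv vr; rewrite ltr_distlC; lra.
  apply: le_lt_trans ir; apply: rV_norm_le => // j; rewrite !mxE.
  have := vp j; rewrite /side/= in_itv/= mxE.
  have := floor_itv (w s 0 j * i.+1%:R).
  rewrite -ler_pdivrMr// -ltr_pdivlMr//.
  have close (x y a h : R) : a <= x < a + h -> a <= y < a + h ->
      - h <= y - x <= h.
    by move=> /andP[? ?] /andP[? ?]; lra.
  by rewrite intrD mulrDl !mul1r ler_norml; exact: close.
rewrite bigcup_mkcond; apply: countable_bigcupT_measurable => // q.
case: ifPn => // _.
have -> : D `&` w @^-1` cell q.1 q.2 =
    D `\` \bigcup_j (D `\` (D `&` (fun s => w s 0 j) @^-1` side q.1 (q.2 0 j))).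
  apply/seteqP; split => s.
    by move=> [Ds ws]; split => // -[j _ [_]]; apply; split => //; exact: ws.
  move=> [Ds ws]; split => // j; apply: contrapT => wsj; apply: ws.
  by exists j => //; split => // -[].
apply: measurableD => //; apply: countable_bigcupT_measurable => // j.
by apply: measurableD => //; apply: mw => //; exact: measurable_itv.
Qed.

Lemma regular_approx n m (g : 'rV[R]_n -> 'rV[R]_m -> 'rV[R]_n)
    (U : set 'rV[R]_m) (e : R) : regular g U -> 0 < e ->
  exists2 d : R, 0 < d & forall z z' v v', U v -> U v' ->
    `|z - z'| < d -> `|v - v'| < d -> `|g z v - g z' v'| < e.
Proof.
move=> [/unif_continuousP + _ _] => /(_ e)/[apply] -[d d0 dP]; exists d => //.
move=> z z' v v' Uv Uv' zz' vv'.
have := dP ((z, v), (z', v')).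
rewrite ball_subspace_ball /subspace_ball /= mem_set// => gball.
suff : ball (g z v) e (g z' v') by rewrite -ball_normE.
by apply: gball; split => //; split; rewrite /= -ball_normE.
Qed.

(** The velocity is a continuous function of the pair (time, control value), so
    only the measurability of time and of [u] is involved. *)
Lemma measurable_field_along n m (g : 'rV[R]_n -> 'rV[R]_m -> 'rV[R]_n)
    (U : set 'rV[R]_m) (t M : R) (u : R -> 'rV[R]_m) (y : R -> 'rV[R]_n) j :
  regular g U -> control U t u -> 0 <= M ->
  (forall l r, t <= l -> l <= r -> r <= 0 -> `|y r - y l| <= M * (r - l)) ->
  measurable_fun (`[t, 0] : set (lebesgue_type R))
    (fun s => g (y s) (u s) 0 j : R).
Proof.
move=> rg [mu uU] M0 lipy.
pose w (s : lebesgue_type R) : 'rV[R]_(1 + m) :=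
  row_mx (const_mx (s : R)) (u s).
pose W : set 'rV[R]_(1 + m) := [set v | t <= lsubmx v 0 0 <= 0 /\ U (rsubmx v)].
pose F (v : 'rV[R]_(1 + m)) : R := g (y (lsubmx v 0 0)) (rsubmx v) 0 j.
have mt0 : measurable (`[t, 0] : set (lebesgue_type R)).
  by apply: borel_lebesgue_measurable; exact: measurable_itv.
rewrite (_ : (fun s => _) = F \o w); last first.
  by apply/funext => s; rewrite /F /w /= row_mxKl row_mxKr mxE.
apply: (@measurable_fun_rV_comp _ _ _ _ _ W) => //.
- move=> i; case: (split_ordP i) => k ->.
    rewrite (_ : (fun s => _) = (fun s : lebesgue_type R => s : R)); last first.
      by apply/funext => s; rewrite row_mxEl mxE.
    move=> _ A mA; apply: measurableI => //.
    exact: borel_lebesgue_measurable.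
  rewrite (_ : (fun s => _) = (fun s => u s 0 k)); first exact: mu.
  by apply/funext => s; rewrite row_mxEr.
- move=> s; rewrite /= in_itv/= => st; split; first by rewrite row_mxKl mxE.
  by rewrite row_mxKr; apply: uU; rewrite in_itv.
- move=> v [v1 v2] e e0; have [d d0 dP] := regular_approx rg e0.
  exists (d / (M + 1)); first by rewrite divr_gt0//; lra.
  move=> v' [v1' v2']; rewrite ltr_pdivlMr; last lra; move=> vv'.
  have vv'd : `|v' - v| < d.
    by apply: le_lt_trans vv'; rewrite ler_peMr//; lra.
  apply: le_lt_trans (rV_dist_coord_le _ _ _) _; apply: dP => //.
  + have lipy' a b : t <= a <= 0 -> t <= b <= 0 -> `|y a - y b| <= M * `|a - b|.
      move=> /andP[? ?] /andP[? ?]; have [ab|ba] := leP a b.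
        by rewrite distrC (distrC a) (ger0_norm (x := b - a)) ?subr_ge0// lipy.
      by rewrite (ger0_norm (x := a - b)) ?subr_ge0 ?lipy// ltW.
    apply: le_lt_trans (lipy' _ _ v1' v1) _.
    apply: le_lt_trans vv'; rewrite mulrC; apply: ler_pM => //; last lra.
    apply: le_trans (rV_dist_coord_le _ _ _) _.
    by rewrite -linearB; exact: norm_lsubmx_le.
  + by rewrite -linearB; exact: le_lt_trans (norm_rsubmx_le _) vv'd.
Qed.

End measurability.

(** * Existence and uniqueness of trajectories *)

Section trajectories.
Context {R : realType} {n m : nat}.
Notation mu := (@lebesgue_measure R).
Implicit Types (g : 'rV[R]_n -> 'rV[R]_m -> 'rV[R]_n) (U : set 'rV[R]_m).
Implicit Types (y : R -> 'rV[R]_n) (u : R -> 'rV[R]_m).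

Lemma is_derive_rV y (s : R) (v : 'rV[R]_n) :
  (forall j, is_derive s (1 : R) (fun r => y r 0 j : R^o) (v 0 j)) ->
  is_derive s (1 : R) y v.
Proof.
move=> yv; apply/is_derive1_approxP => e e0.
have /choice[d dP] : forall j, exists d : R, 0 < d /\ forall r, `|r - s| < d ->
    `|y r 0 j - y s 0 j - (r - s) * v 0 j| <= e * `|r - s|.
  by move=> j; have [d] := (is_derive1_approxP _ _ _).1 (yv j) _ e0; exists d.
exists (\big[Num.min/1]_j d j).
  by apply: lt_bigmin => // j _; have [] := dP j.
move=> r rd; apply: rV_norm_le => [|j]; first by rewrite mulr_ge0// ltW.
rewrite !mxE; apply: (dP j).2; apply: lt_le_trans rd _.
exact: bigmin_le.
Qed.

(** The Picard operator. It maps into the [M]-Lipschitz functions, which are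
    absolutely continuous and stable under pointwise limits. *)
Lemma field_primitive g U (t M : R) u y (x : 'rV[R]_n) : regular g U ->
  control U t u -> 0 <= M -> (forall z v, U v -> `|g z v| <= M) ->
  (forall l r, t <= l -> l <= r -> r <= 0 -> `|y r - y l| <= M * (r - l)) ->
  exists Y : R -> 'rV[R]_n, [/\ Y t = x,
    forall l r, t <= l -> l <= r -> r <= 0 -> `|Y r - Y l| <= M * (r - l) &
    {ae mu, forall s, s \in `[t, 0] -> is_derive s (1 : R) Y (g (y s) (u s))}].
Proof.
move=> rg cu M0 gM lipy.
have /choice[Phi PhiP] : forall j, exists Phi : R -> R, [/\ Phi t = 0,
    forall l r, t <= l -> l <= r -> r <= 0 -> `|Phi r - Phi l| <= M * (r - l) &
    {ae mu, forall s, s \in `[t, 0] ->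
       is_derive s (1 : R) (Phi : R -> R^o) (g (y s) (u s) 0 j)}].
  move=> j; apply: bounded_measurable_primitive => //.
    exact: measurable_field_along rg cu M0 lipy.
  move=> s st; apply: le_trans (rV_norm_coord_le _ _) (gM _ _ _).
  by apply: cu.2.
exists (fun s => x + \row_j Phi j s); split.
- apply/rowP => j; rewrite !mxE; have [-> _ _] := PhiP j; exact: addr0.
- move=> l r tl lr r0; rewrite opprD addrACA subrr add0r.
  apply: rV_norm_le => [|j]; first by rewrite mulr_ge0 ?subr_ge0.
  by rewrite !mxE; have [_ + _] := PhiP j; apply.
- have aePhi : {ae mu, forall s, forall j, s \in `[t, 0] ->
       is_derive s (1 : R) (Phi j : R -> R^o) (g (y s) (u s) 0 j)}.
    apply: (@filter_forall _ _ _ _ (ae_filter_ringOfSetsType mu)) => j.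
    by have [] := PhiP j.
  apply: (@filterS _ _ (ae_filter_ringOfSetsType mu) _ _ _ aePhi) => s sPhi st.
  apply: is_derive_rV => j; apply/is_derive1_approxP => e e0.
  have [d d0 dP] := (is_derive1_approxP _ _ _).1 (sPhi j st) _ e0.
  exists d => // r /dP; rewrite !mxE; apply: le_trans.
  by rewrite opprD addrACA subrr add0r.
Qed.

(** The difference of two trajectories is bounded in weighted norm because the
    velocities are, and this bound can be halved indefinitely. *)
Theorem trajectory_unique g U (t : R) u (x : 'rV[R]_n) y1 y2 :
  (exists M : R, forall z v, U v -> `|g z v| <= M) ->
  (exists L : R, forall z z' v, U v -> `|g z v - g z' v| <= L * `|z - z'|) ->
  control U t u -> is_trajectory g t x u y1 -> is_trajectory g t x u y2 ->
  forall s, s \in `[t, 0] -> y1 s = y2 s.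
Proof.
move=> [M gM] [L0 gL0] [_ uU] [y1t ac1 d1] [y2t ac2 d2] s0 s0t.
pose L := `|L0|; have Lge0 : 0 <= L by exact: normr_ge0.
have gL z z' v : U v -> `|g z v - g z' v| <= L * `|z - z'|.
  by move=> Uv; apply: le_trans (gL0 _ _ _ Uv) _; rewrite ler_wpM2r// ler_norm.
pose w s := y1 s - y2 s; pose dw s := g (y1 s) (u s) - g (y2 s) (u s).
have acw : absolutely_continuous_on t 0 w by exact: absolutely_continuous_onB.
have wt : w t = 0 by rewrite /w y1t y2t subrr.
have dwP : {ae mu, forall s, s \in `[t, 0] -> is_derive s (1 : R) w (dw s)}.
  apply: (@filterS2 _ _ (ae_filter_ringOfSetsType mu) _ _ _ _ d1 d2).
  by move=> s d1s d2s st; apply: is_deriveB; [exact: d1s|exact: d2s].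
pose C := `|M| * 2 * - t.
have t0 : t <= 0 by move: s0t; rewrite in_itv/= => /andP[]; exact: le_trans.
have C0 : 0 <= C by rewrite !mulr_ge0 ?oppr_ge0.
have bound k : forall s, s \in `[t, 0] -> `|w s| <= C / 2 ^+ k * bielecki L t s.
  elim: k => [|k IH] s st.
    have : `|w s - w t| <= `|M| * 2 * (s - t) - `|M| * 2 * (t - t).
      apply: (absolutely_continuous_mean_value_le (h := fun=> `|M| * 2)
        (H := fun s => `|M| * 2 * (s - t)) acw _ _ dwP).
      - by move=> r; exact: is_derive_affine.
      - by move=> a b ab; rewrite ler_wpM2l ?mulr_ge0// lerD2r.
      - move=> r rt; apply: le_trans (ler_normB _ _) _.
        have := gM (y1 r) _ (uU r rt); have := gM (y2 r) _ (uU r rt).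
        have := ler_norm M; lra.
      - by [].
    rewrite wt subr0 subrr mulr0 subr0 => /le_trans; apply; rewrite expr0 divr1.
    move: (st); rewrite in_itv/= => /andP[ts s00].
    have := bielecki_ge1 Lge0 ts => /(ler_wpM2l C0).
    rewrite mulr1; apply: le_trans; rewrite ler_wpM2l ?mulr_ge0//; lra.
  rewrite exprSr invfM mulrA.
  apply: (bielecki_contraction _ _ acw wt dwP _ st) => [||r rt].
  - by [].
  - by rewrite divr_ge0// exprn_ge0.
  - by apply: le_trans (gL _ _ _ (uU _ rt)) _; rewrite ler_wpM2l ?IH.
apply/eqP; rewrite -subr_eq0 -normr_le0.
apply: (@le_of_halving _ _ _ (C * bielecki L t s0)) => k.
by rewrite add0r mulrAC; exact: bound.
Qed.


Lemma regular_lipschitz g U : regular g U -> exists2 L : R, 0 <= L &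
  forall z z' v, U v -> `|g z v - g z' v| <= L * `|z - z'|.
Proof.
move=> [_ _ [L gL]]; exists `|L| => // z z' v Uv.
have /= := gL v Uv (z, z') (conj I I); move/le_trans; apply.
by rewrite ler_wpM2r// ler_norm.
Qed.

Lemma cvg_of_halving_increments (z : nat -> 'rV[R]_n) (C : R) :
  (forall k, `|z k.+1 - z k| <= C / 2 ^+ k) ->
  exists l, forall k, `|l - z k| <= C * 2 / 2 ^+ k.
Proof.
move=> dz.
have tail k p : `|z (k + p)%N - z k| <= C * 2 / 2 ^+ k - C * 2 / 2 ^+ (k + p).
  elim: p => [|p IH]; first by rewrite addn0 !subrr normr0.
  have := ler_distD (z (k + p)%N) (z (k + p.+1)%N) (z k).
  have E1 : C * 2 / 2 ^+ (k + p).+1 = C / 2 ^+ (k + p).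
    by rewrite exprS; field; rewrite expf_neq0.
  have E2 : C * 2 / 2 ^+ (k + p) = C / 2 ^+ (k + p) + C / 2 ^+ (k + p) by ring.
  by rewrite addnS E1; move: IH (dz (k + p)%N); rewrite E2; lra.
have C0 : 0 <= C by have := dz 0; rewrite expr0 divr1; apply: le_trans.
have bound k p : `|z (k + p)%N - z k| <= C * 2 / 2 ^+ k.
  apply: le_trans (tail k p) _.
  by rewrite gerBl divr_ge0 ?mulr_ge0// exprn_ge0.
have cz : cvgn z.
  apply/cauchy_cvgP/cauchy_exP => e e0.
  have [N Ne] := halving_lt (C * 2) e0.
  exists (z N); exists N => // p /= Np; rewrite -ball_normE/= distrC.
  by rewrite -(subnKC Np); exact: le_lt_trans (bound _ _) Ne.
exists (limn z) => k.
apply/ler_addgt0Pr => e e0.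
have /cvgrPdist_le/(_ _ e0)[N _ /(_ (k + N)%N (leq_addl _ _)) zN] := cz.
by have := ler_distD (z (k + N)%N) (limn z) (z k); have := bound k N; lra.
Qed.

(** Picard iteration: the increments of consecutive iterates are halved in the
    weighted norm. The limit [z] need not be differentiated: the trajectory is
    its image [P z], which has the derivative [g (z s) (u s)] almost everywhere
    and agrees with [z] on the interval. *)
Theorem trajectory_exists g U (t : R) u (x : 'rV[R]_n) : t <= 0 ->
  regular g U -> control U t u -> exists y, is_trajectory g t x u y.
Proof.
move=> t0 rg cu; have [L L0 gL] := regular_lipschitz rg.
have [M M0 gM] : exists2 M : R, 0 <= M & forall z v, U v -> `|g z v| <= M.
  have [_ [M gM] _] := rg; exists `|M| => // z v Uv.
  exact: le_trans (gM _ _ Uv) (ler_norm _).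
pose lip y := forall l r,
  t <= l -> l <= r -> r <= 0 -> `|y r - y l| <= M * (r - l).
have lip_ac y : lip y -> absolutely_continuous_on t 0 y.
  exact: lipschitz_absolutely_continuous.
have /choice[P PP] : forall y, exists Y, lip y -> [/\ Y t = x, lip Y &
    {ae mu, forall s, s \in `[t, 0] -> is_derive s (1 : R) Y (g (y s) (u s))}].
  move=> y; have [lipy|nlipy] := pselect (lip y); last by exists y.
  by have [Y YP] := field_primitive x rg cu M0 gM lipy; exists Y.
pose W := bielecki L t.
have W1 s : s \in `[t, 0] -> 1 <= W s.
  by rewrite in_itv/= => /andP[ts _]; exact: bielecki_ge1.
have contraction y1 y2 (C : R) : lip y1 -> lip y2 -> 0 <= C ->
    (forall s, s \in `[t, 0] -> `|y1 s - y2 s| <= C * W s) ->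
    forall s, s \in `[t, 0] -> `|P y1 s - P y2 s| <= C / 2 * W s.
  move=> lip1 lip2 C0 y12.
  have [P1t lipP1 dP1] := PP _ lip1; have [P2t lipP2 dP2] := PP _ lip2.
  apply: (@bielecki_contraction _ _ L C t 0 (fun s => P y1 s - P y2 s)
    (fun s => g (y1 s) (u s) - g (y2 s) (u s))) => //.
  - by apply: absolutely_continuous_onB; exact: lip_ac.
  - by rewrite P1t P2t subrr.
  - apply: (@filterS2 _ _ (ae_filter_ringOfSetsType mu) _ _ _ _ dP1 dP2).
    by move=> s d1s d2s st; apply: is_deriveB; [exact: d1s|exact: d2s].
  - move=> s st; apply: le_trans (gL _ _ _ (cu.2 _ st)) _.
    by rewrite ler_wpM2l// y12.
pose y k := iter k P (fun=> x).
have lipy k : lip (y k).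
  elim: k => [|k IH]; last by have [] := PP _ IH.
  by move=> l r _ lr _; rewrite subrr normr0 mulr_ge0// subr_ge0.
pose C := M * - t; have C0 : 0 <= C by rewrite mulr_ge0// oppr_ge0.
have dy k : forall s, s \in `[t, 0] -> `|y k.+1 s - y k s| <= C / 2 ^+ k * W s.
  elim: k => [|k IH] s st; last first.
    rewrite exprSr invfM mulrA; apply: (contraction (y k.+1) (y k)) => //.
    by rewrite divr_ge0// exprn_ge0.
  have [y1t lipy1 _] := PP _ (lipy 0).
  rewrite expr0 divr1; apply: (@le_trans _ _ C); last by rewrite ler_peMr// W1.
  rewrite -[y 0%N s]/x -y1t; move: st; rewrite in_itv/= => /andP[ts s0].
  by apply: le_trans (lipy1 _ _ _ ts s0) _ => //; rewrite ler_wpM2l//; lra.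
have /choice[z zP] : forall s, exists l, s \in `[t, 0] ->
    forall k, `|l - y k s| <= C * W s * 2 / 2 ^+ k.
  move=> s; have [st|_] := boolP (s \in `[t, 0]); last by exists 0.
  have [k|l lP] := @cvg_of_halving_increments (y ^~ s) (C * W s);
    last by exists l.
  by rewrite mulrAC; exact: dy.
have lipz : lip z.
  move=> l r tl lr r0.
  have lt0 : l \in `[t, 0] by rewrite in_itv/= tl (le_trans lr).
  have rt0 : r \in `[t, 0] by rewrite in_itv/= r0 (le_trans tl).
  apply: (@le_of_halving _ _ _ (C * W l * 2 + C * W r * 2)) => k.
  have := lipy k _ _ tl lr r0; have := zP _ lt0 k; have := zP _ rt0 k.
  have := ler_distD (y k r) (z r) (z l).
  have := ler_distD (y k l) (y k r) (z l).
  rewrite mulrDl (distrC (y k l) (z l)); lra.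
have [Pt lipP dP] := PP _ lipz.
have Pz s : s \in `[t, 0] -> P z s = z s.
  move=> st; apply/eqP; rewrite -subr_eq0 -normr_le0.
  apply: (@le_of_halving _ _ _ (C * 2 * W s)) => k; rewrite add0r.
  have zy r : r \in `[t, 0] -> `|z r - y k r| <= C * 2 / 2 ^+ k * W r.
    move=> rt; apply: le_trans (zP r rt k) _.
    by rewrite le_eqVlt; apply/orP; left; apply/eqP; ring.
  have Ck : 0 <= C * 2 / 2 ^+ k by rewrite divr_ge0 ?exprn_ge0 ?(mulr_ge0 C0).
  have := contraction _ _ _ lipz (lipy k) Ck zy s st.
  have := zP _ st k.+1.
  have -> : C * W s * 2 / 2 ^+ k.+1 = C * 2 / 2 ^+ k / 2 * W s.
    by rewrite exprS; field; rewrite expf_neq0.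
  have -> : C * 2 * W s / 2 ^+ k =
      C * 2 / 2 ^+ k / 2 * W s + C * 2 / 2 ^+ k / 2 * W s.
    by field; rewrite expf_neq0.
  have := ler_distD (y k.+1 s) (P z s) (z s).
  rewrite (distrC (y k.+1 s)); lra.
exists (P z); split => //; first exact: lip_ac.
apply: (@filterS _ _ (ae_filter_ringOfSetsType mu) _ _ _ dP) => s dPs st.
by rewrite Pz//; exact: dPs.
Qed.

End trajectories.

(** * Trajectories of self-contained subsystems *)

Section projection.
Context {R : realType} {n p m : nat}.
(** [pi] takes the full state to the state of a subsystem that evolves on its
    own, and [iota] fills in the remaining coordinates. *)
Variables (pi : {linear 'rV[R]_n -> 'rV[R]_p}) (iota : 'rV[R]_p -> 'rV[R]_n).
Hypothesis pi_le : forall z, `|pi z| <= `|z|.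
Hypothesis iotaK : cancel iota pi.
Hypothesis iota_le : forall x x', `|iota x - iota x'| <= `|x - x'|.
Notation mu := (@lebesgue_measure R).

Lemma is_trajectory_projection (g : 'rV[R]_n -> 'rV[R]_m -> 'rV[R]_n)
    (g' : 'rV[R]_p -> 'rV[R]_m -> 'rV[R]_p) (U : set 'rV[R]_m) (t : R) z u y :
  (forall z v, U v -> pi (g z v) = g' (pi z) v) -> control U t u ->
  is_trajectory g t z u y -> is_trajectory g' t (pi z) u (pi \o y).
Proof.
move=> gg' [_ uU] [yt acy dy]; split; first by rewrite /= yt.
- move=> e /acy[d d0 dP]; exists d => // k l r lr sep len.
  apply: le_lt_trans (dP k l r lr sep len); apply: ler_sum => i _ /=.
  by rewrite -linearB.
- apply: (@filterS _ _ (ae_filter_ringOfSetsType mu) _ _ _ dy) => s dys st.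
  apply/is_derive1_approxP => e e0.
  have [d d0 dP] := (is_derive1_approxP _ _ _).1 (dys st) _ e0.
  exists d => // r /dP; apply: le_trans; rewrite /= -gg'; last exact: uU.
  by rewrite -linearZ -!linearB.
Qed.

(** The projection of the full trajectory solves the equation of the subsystem,
    whose solutions are unique: [iota] transfers the bound and the Lipschitz
    constant from [g] to [g']. This uses the existence of the full trajectory,
    without which its projection is meaningless. *)
Lemma trajectory_projection (g : 'rV[R]_n -> 'rV[R]_m -> 'rV[R]_n)
    (g' : 'rV[R]_p -> 'rV[R]_m -> 'rV[R]_p) (U : set 'rV[R]_m) (t : R) z u s :
  regular g U -> (forall z v, U v -> pi (g z v) = g' (pi z) v) ->
  control U t u -> s \in `[t, 0] ->
  trajectory g' t (pi z) u s = pi (trajectory g t z u s).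
Proof.
move=> rg gg' cu st.
have t0 : t <= 0 by move: st; rewrite in_itv/= => /andP[]; exact: le_trans.
have gE x v : U v -> g' x v = pi (g (iota x) v).
  by move=> Uv; rewrite gg'// iotaK.
have gtraj : is_trajectory g t z u (trajectory g t z u).
  exact: getPex (trajectory_exists z t0 rg cu).
have g'traj := is_trajectory_projection gg' cu gtraj.
have subtraj : is_trajectory g' t (pi z) u (trajectory g' t (pi z) u).
  by apply: getPex; exists (pi \o trajectory g t z u).
apply: (trajectory_unique _ _ cu subtraj g'traj st).
- have [_ [M gM] _] := rg; exists M => x v Uv; rewrite gE//.
  exact: le_trans (pi_le _) (gM _ _ Uv).
- have [L L0 gL] := regular_lipschitz rg; exists L => x x' v Uv; rewrite !gE//.
  rewrite -linearB; apply: le_trans (pi_le _) _.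
  apply: le_trans (gL _ _ _ Uv) _.
  by rewrite ler_wpM2l.
Qed.

End projection.

Section partition.
Context {R : realType} {n1 n2 nc : nat}.

Lemma norm_row_mx_le n p (a : 'rV[R]_n) (b : 'rV[R]_p) (e : R) :
  `|a| <= e -> `|b| <= e -> `|row_mx a b| <= e.
Proof.
move=> ae be; apply: rV_norm_le => [|j]; first exact: le_trans ae.
case: (split_ordP j) => k ->; rewrite ?row_mxEl ?row_mxEr;
  exact: le_trans (rV_norm_coord_le _ _) _.
Qed.

Definition substate1 (z : 'rV[R]_(n1 + n2 + nc)) : 'rV[R]_(n1 + nc) :=
  row_mx (part1 z) (partc z).
Definition substate2 (z : 'rV[R]_(n1 + n2 + nc)) : 'rV[R]_(n2 + nc) :=
  row_mx (part2 z) (partc z).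

Lemma substate1_linear : linear substate1.
Proof.
move=> c z z'; rewrite /substate1 /part1 /partc !linearP.
by rewrite scale_row_mx add_row_mx.
Qed.

Lemma substate2_linear : linear substate2.
Proof.
move=> c z z'; rewrite /substate2 /part2 /partc !linearP.
by rewrite scale_row_mx add_row_mx.
Qed.

HB.instance Definition _ := GRing.isLinear.Build R _ _ _
  substate1 substate1_linear.
HB.instance Definition _ := GRing.isLinear.Build R _ _ _
  substate2 substate2_linear.

Lemma norm_substate1_le z : `|substate1 z| <= `|z|.
Proof.
apply: norm_row_mx_le; last exact: norm_rsubmx_le.
exact: le_trans (norm_lsubmx_le _) (norm_lsubmx_le _).
Qed.

Lemma norm_substate2_le z : `|substate2 z| <= `|z|.
Proof.
apply: norm_row_mx_le; last exact: norm_rsubmx_le.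
exact: le_trans (norm_rsubmx_le _) (norm_lsubmx_le _).
Qed.

Definition extend1 (x : 'rV[R]_(n1 + nc)) : 'rV[R]_(n1 + n2 + nc) :=
  row_mx (row_mx (lsubmx x) 0) (rsubmx x).
Definition extend2 (x : 'rV[R]_(n2 + nc)) : 'rV[R]_(n1 + n2 + nc) :=
  row_mx (row_mx 0 (lsubmx x)) (rsubmx x).

Lemma extend1K : cancel extend1 substate1.
Proof.
by move=> x; rewrite /substate1 /part1 /partc !(row_mxKl, row_mxKr) hsubmxK.
Qed.

Lemma extend2K : cancel extend2 substate2.
Proof.
by move=> x; rewrite /substate2 /part2 /partc !(row_mxKl, row_mxKr) hsubmxK.
Qed.

Lemma norm_extend1_le x x' : `|extend1 x - extend1 x'| <= `|x - x'|.
Proof.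
rewrite !opp_row_mx !add_row_mx subrr -!linearB.
apply: norm_row_mx_le; last exact: norm_rsubmx_le.
by apply: norm_row_mx_le; [exact: norm_lsubmx_le|rewrite normr0].
Qed.

Lemma norm_extend2_le x x' : `|extend2 x - extend2 x'| <= `|x - x'|.
Proof.
rewrite !opp_row_mx !add_row_mx subrr -!linearB.
apply: norm_row_mx_le; last exact: norm_rsubmx_le.
by apply: norm_row_mx_le; [rewrite normr0|exact: norm_lsubmx_le].
Qed.

(** * Decomposition of the reachable tubes *)

Section decomposition.
Variables (nu : nat) (U : set 'rV[R]_nu) (t : R).
Variable f : 'rV[R]_(n1 + n2 + nc) -> 'rV[R]_nu -> 'rV[R]_(n1 + n2 + nc).
Variable f1 : 'rV[R]_n1 -> 'rV[R]_nc -> 'rV[R]_nu -> 'rV[R]_n1.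
Variable f2 : 'rV[R]_n2 -> 'rV[R]_nc -> 'rV[R]_nu -> 'rV[R]_n2.
Variable fc : 'rV[R]_nc -> 'rV[R]_nu -> 'rV[R]_nc.
Hypothesis regf : regular f U.
Hypothesis fE : forall z v, U v -> f z v = coupled_dynamics f1 f2 fc z v.

Lemma trajectory_substate1 z u s : control U t u -> s \in `[t, 0] ->
  trajectory (subsystem_dynamics f1 fc) t (substate1 z) u s =
    substate1 (trajectory f t z u s).
Proof.
apply: (trajectory_projection norm_substate1_le extend1K
  norm_extend1_le _ regf).
move=> {}z v Uv; rewrite fE//=.
rewrite /subsystem_dynamics /coupled_dynamics /substate1 /part1 /partc.
by rewrite !(row_mxKl, row_mxKr).
Qed.

Lemma trajectory_substate2 z u s : control U t u -> s \in `[t, 0] ->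
  trajectory (subsystem_dynamics f2 fc) t (substate2 z) u s =
    substate2 (trajectory f t z u s).
Proof.
apply: (trajectory_projection norm_substate2_le extend2K
  norm_extend2_le _ regf).
move=> {}z v Uv; rewrite fE//=.
rewrite /subsystem_dynamics /coupled_dynamics /substate2 /part2 /partc.
by rewrite !(row_mxKl, row_mxKr).
Qed.

Variables (T1 : set 'rV[R]_(n1 + nc)) (T2 : set 'rV[R]_(n2 + nc)).

Lemma target_trajectoryE z u s : control U t u -> s \in `[t, 0] ->
  (back_proj1 T1 `|` back_proj2 T2) (trajectory f t z u s) <->
  T1 (trajectory (subsystem_dynamics f1 fc) t (substate1 z) u s) \/
  T2 (trajectory (subsystem_dynamics f2 fc) t (substate2 z) u s).
Proof. by move=> cu st; rewrite trajectory_substate1// trajectory_substate2. Qed.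

(** One control and one time witness both sides, as an existential quantifier
    distributes over the union. *)
Theorem maximal_BRT_decomposition :
  maximal_BRT f U (back_proj1 T1 `|` back_proj2 T2) t =
    back_proj1 (maximal_BRT (subsystem_dynamics f1 fc) U T1 t) `|`
    back_proj2 (maximal_BRT (subsystem_dynamics f2 fc) U T2 t).
Proof.
apply/seteqP; split => z.
- move=> [u [cu [s [st /(target_trajectoryE _ cu st)[Ts|Ts]]]]]; [left|right];
    by exists u; split => //; exists s.
- by move=> [[u [cu [s [st Ts]]]]|[u [cu [s [st Ts]]]]]; exists u; split => //;
    exists s; split => //; apply/(target_trajectoryE _ cu st); [left|right].
Qed.

End decomposition.
End partition.

Lemma trajectory_eq_control (R : realType) n m
    (g : 'rV[R]_n -> 'rV[R]_m -> 'rV[R]_n) t x (u u' : R -> 'rV[R]_m) :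
  (forall s z, g z (u s) = g z (u' s)) ->
  trajectory g t x u = trajectory g t x u'.
Proof.
move=> uu'; rewrite /trajectory; congr get; apply/funext => y.
rewrite /is_trajectory.
congr and3; congr (almost_everywhere _ _).
by apply/funext => s; rewrite uu'.
Qed.

Section independent_controls.
Context {R : realType} {nu1 nu2 : nat}.
Variables (U1 : set 'rV[R]_nu1) (U2 : set 'rV[R]_nu2) (t : R).

Definition splice_controls (u u' : R -> 'rV[R]_(nu1 + nu2)) (s : R) :=
  row_mx (lsubmx (u s)) (rsubmx (u' s)).

Lemma control_splice u u' : control (control_product U1 U2) t u ->
  control (control_product U1 U2) t u' ->
  control (control_product U1 U2) t (splice_controls u u').
Proof.
move=> [mu uU] [mu' u'U]; split => [j|s st].
- case: (split_ordP j) => k ->.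
  + rewrite (_ : (fun s => _) = (fun s => u s 0 (lshift nu2 k)));
      first exact: mu.
    by apply/funext => s; rewrite row_mxEl mxE.
  + rewrite (_ : (fun s => _) = (fun s => u' s 0 (rshift nu1 k)));
      first exact: mu'.
    by apply/funext => s; rewrite row_mxEr mxE.
- split; rewrite ?row_mxKl ?row_mxKr; first exact: (uU s st).1.
  exact: (u'U s st).2.
Qed.

Context {n1 n2 nc : nat}.
Variable f :
  'rV[R]_(n1 + n2 + nc) -> 'rV[R]_(nu1 + nu2) -> 'rV[R]_(n1 + n2 + nc).
Variable f1 : 'rV[R]_n1 -> 'rV[R]_nc -> 'rV[R]_nu1 -> 'rV[R]_n1.
Variable f2 : 'rV[R]_n2 -> 'rV[R]_nc -> 'rV[R]_nu2 -> 'rV[R]_n2.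
Variable fc : 'rV[R]_nc -> 'rV[R]_nc.
Let U := control_product U1 U2.
Let g1 z1 zc (v : 'rV[R]_(nu1 + nu2)) := f1 z1 zc (lsubmx v).
Let g2 z2 zc (v : 'rV[R]_(nu1 + nu2)) := f2 z2 zc (rsubmx v).
Let gc zc (_ : 'rV[R]_(nu1 + nu2)) := fc zc.
Hypothesis regf : regular f U.
Hypothesis fE : forall z v, U v -> f z v = coupled_dynamics g1 g2 gc z v.
Variables (T1 : set 'rV[R]_(n1 + nc)) (T2 : set 'rV[R]_(n2 + nc)).

(** A universal quantifier over controls does not distribute over a union. But
    if one control keeps subsystem 1 out of [T1] and another keeps subsystem 2
    out of [T2], then splicing their components keeps the full system out of
    both back-projections. *)
Theorem minimal_BRT_decomposition :
  minimal_BRT f U (back_proj1 T1 `|` back_proj2 T2) t =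
    back_proj1 (minimal_BRT (subsystem_dynamics g1 gc) U T1 t) `|`
    back_proj2 (minimal_BRT (subsystem_dynamics g2 gc) U T2 t).
Proof.
apply/seteqP; split => z; last first.
  by move=> [] zA u cu; have [s [st Ts]] := zA u cu; exists s; split => //;
    apply/(target_trajectoryE regf fE _ _ _ cu st); [left|right].
move=> zA; apply: contrapT => /not_orP[].
move=> /existsNP[u1 /not_implyP[cu1 avoid1]].
move=> /existsNP[u2 /not_implyP[cu2 avoid2]].
have cu := control_splice cu1 cu2.
have [s [st /(target_trajectoryE regf fE _ _ _ cu st)[Ts|Ts]]] := zA _ cu.
- apply: avoid1; exists s; split => //.
  rewrite -(trajectory_eq_control _ _ (u := splice_controls u1 u2))// => r x.
  by rewrite /subsystem_dynamics /g1 row_mxKl.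
- apply: avoid2; exists s; split => //.
  rewrite -(trajectory_eq_control _ _ (u := splice_controls u1 u2))// => r x.
  by rewrite /subsystem_dynamics /g2 row_mxKr.
Qed.

End independent_controls.

Theorem proposition3 (R : realType) (n1 n2 nc : nat)
    (n1_gt0 : (0 < n1)%N) (n2_gt0 : (0 < n2)%N)
    (T : set 'rV[R]_(n1 + n2 + nc))
    (T1 : set 'rV[R]_(n1 + nc)) (T2 : set 'rV[R]_(n2 + nc))
    (t : R) (t_lt0 : t < 0)
    (defT : T = back_proj1 T1 `|` back_proj2 T2) :
  (* (1) *)
  (forall (nu : nat) (U : set 'rV[R]_nu)
      (f : 'rV[R]_(n1 + n2 + nc) -> 'rV[R]_nu -> 'rV[R]_(n1 + n2 + nc))
      (f1 : 'rV[R]_n1 -> 'rV[R]_nc -> 'rV[R]_nu -> 'rV[R]_n1)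
      (f2 : 'rV[R]_n2 -> 'rV[R]_nc -> 'rV[R]_nu -> 'rV[R]_n2)
      (fc : 'rV[R]_nc -> 'rV[R]_nu -> 'rV[R]_nc),
    compact U -> regular f U ->
    (forall z v, U v -> f z v = coupled_dynamics f1 f2 fc z v) ->
    maximal_BRT f U T t =
      back_proj1 (maximal_BRT (subsystem_dynamics f1 fc) U T1 t) `|`
      back_proj2 (maximal_BRT (subsystem_dynamics f2 fc) U T2 t))
  /\
  (* (2) *)
  (forall (nu1 nu2 : nat) (U1 : set 'rV[R]_nu1) (U2 : set 'rV[R]_nu2)
      (f : 'rV[R]_(n1 + n2 + nc) -> 'rV[R]_(nu1 + nu2) ->
           'rV[R]_(n1 + n2 + nc))
      (f1 : 'rV[R]_n1 -> 'rV[R]_nc -> 'rV[R]_nu1 -> 'rV[R]_n1)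
      (f2 : 'rV[R]_n2 -> 'rV[R]_nc -> 'rV[R]_nu2 -> 'rV[R]_n2)
      (fc : 'rV[R]_nc -> 'rV[R]_nc),
    let U := control_product U1 U2 in
    let g1 := fun z1 zc (v : 'rV[R]_(nu1 + nu2)) => f1 z1 zc (lsubmx v) in
    let g2 := fun z2 zc (v : 'rV[R]_(nu1 + nu2)) => f2 z2 zc (rsubmx v) in
    let gc := fun zc (_ : 'rV[R]_(nu1 + nu2)) => fc zc in
    compact U -> regular f U ->
    (forall z v, U v -> f z v = coupled_dynamics g1 g2 gc z v) ->
    maximal_BRT f U T t =
      back_proj1 (maximal_BRT (subsystem_dynamics g1 gc) U T1 t) `|`
      back_proj2 (maximal_BRT (subsystem_dynamics g2 gc) U T2 t) /\
    minimal_BRT f U T t =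
      back_proj1 (minimal_BRT (subsystem_dynamics g1 gc) U T1 t) `|`
      back_proj2 (minimal_BRT (subsystem_dynamics g2 gc) U T2 t)).
Proof.
rewrite defT; split=> [nu U f f1 f2 fc _ regf fE|].
  exact: maximal_BRT_decomposition.
move=> nu1 nu2 U1 U2 f f1 f2 fc U g1 g2 gc _ regf fE.
by split; [exact: maximal_BRT_decomposition|exact: minimal_BRT_decomposition].
Qed.
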